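(* For $i\in\{1,2,3\}$ let $\chi_i=A_i|\Phi^+\rangle\langle\Phi^+|+B_i|\Psi^-\rangle\langle\Psi^-|+C_i|\Psi^+\rangle\langle\Psi^+|+D_i|\Phi^-\rangle\langle\Phi^-|$ be a Bell-diagonal two-qubit density matrix on $\mathcal H_{iA}\otimes\mathcal H_{iB}$, and let $\rho_{\rm in}=\chi_1\otimes\chi_2\otimes\chi_3$. With $\hat O^i,\hat P^i,\hat F^j$ ($i,j\in\{00,11\}$) as defined in the context, put $$N_1=\sum_{i,j\in\{00,11\}}\hat F^j\hat O^i\rho_{\rm in}\hat O^{i\dagger}\hat F^{j\dagger},\qquad N_2=\sum_{i,j\in\{00,11\}}\hat F^j\hat P^i\rho_{\rm in}\hat P^{i\dagger}\hat F^{j\dagger},$$ $$M_1=\sum_{i,j\in\{00,11\}}\hat F^j\hat P^i\rho_{\rm in}\hat O^{i\dagger}\hat F^{j\dagger},\qquad M_2=\sum_{i,j\in\{00,11\}}\hat F^j\hat O^i\rho_{\rm in}\hat P^{i\dagger}\hat F^{j\dagger}.$$ Define $$\hat Q_1=\sqrt2\,\langle 00|_{2A,2B}\,\mathrm{SWAP}^{3A}_{2A}\,\mathrm{SWAP}^{3B}_{2B}\,\mathrm{CNOT}^{3A}_{2A}\,\mathrm{CNOT}^{3B}_{2B}\,\hat R_{2A,3A}\,\hat R^\dagger_{2B,3B},$$ $$\hat Q_2=\sqrt2\,\langle 00|_{1A,1B}\,\mathrm{SWAP}^{3A}_{1A}\,\mathrm{SWAP}^{3B}_{1B}\,\mathrm{CNOT}^{3A}_{1A}\,\mathrm{CNOT}^{3B}_{1B}\,\hat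 R_{1A,3A}\,\hat R^\dagger_{1B,3B}.$$ Then, under the canonical identification of the output space $\mathcal H_{1A}\otimes\mathcal H_{1B}$ of the left-hand sides with the output space $\mathcal H_{3A}\otimes\mathcal H_{3B}$ of the right-hand sides, $$N_1=\hat Q_2\hat Q_1\,\rho_{\rm in}\,\hat Q_1^\dagger\hat Q_2^\dagger,\qquad N_2=\hat Q_1\hat Q_2\,\rho_{\rm in}\,\hat Q_2^\dagger\hat Q_1^\dagger,$$ $$M_1=\hat Q_1\hat Q_2\,\rho_{\rm in}\,\hat Q_1^\dagger\hat Q_2^\dagger,\qquad M_2=\hat Q_2\hat Q_1\,\rho_{\rm in}\,\hat Q_2^\dagger\hat Q_1^\dagger.$$ Moreover, up to the SWAP gates, which only relabel the Hilbert spaces of the subsystems, $\hat Q_1$ (respectively $\hat Q_2$) is the Kraus operator $\sqrt2\,\langle00|_{yA,yB}\,\mathrm{CNOT}^{yA}_{xA}\mathrm{CNOT}^{yB}_{xB}\hat R_{xA,yA}\hat R^\dagger_{xB,yB}$ of a single DEJMPS step that only projects the parity-measured pair onto $|00\rangle$, with $(x,y)=(2,3)$ (respectively $(x,y)=(1,3)$).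
   Context: All spaces $\mathcal H_{iA},\mathcal H_{iB}$ ($i=1,2,3$) are copies of $\mathbb C^2$ with computational basis $|0\rangle,|1\rangle$; pair $i$ lives on $\mathcal H_{iA}\otimes\mathcal H_{iB}$. Bell states: $|\Phi^\pm\rangle=\frac1{\sqrt2}(|00\rangle\pm|11\rangle)$, $|\Psi^\pm\rangle=\frac1{\sqrt2}(|01\rangle\pm|10\rangle)$. The coefficients $A_i,B_i,C_i,D_i$ are nonnegative with $A_i+B_i+C_i+D_i=1$. Gates: $\hat R=\exp(-i\frac{\pi}{4}\hat X)$ with $\hat X$ the Pauli $X$ matrix; $\hat R_{u,v}=\hat R_u\otimes\hat R_v$ and $\hat R^\dagger_{u,v}=\hat R^\dagger_u\otimes\hat R^\dagger_v$ act on the qubits $u,v$. $\mathrm{CNOT}^{v}_{u}$ is the CNOT gate with control qubit $u$ and target qubit $v$. $\mathrm{SWAP}^{v}_{u}$ exchanges the states of qubits $u$ and $v$. For $i\in\{00,11\}$, $\langle i|_{yA,yB}$ is the partial inner product with the basis vector $|i\rangle$ of $\mathcal H_{yA}\otimes\mathcal H_{yB}$; it removes pair $y$ and leaves the remaining pairs. Operators are extended by the identity on the remaining pairs not mentioned. Kraus operators: $$\hat O^i=\langle i|_{3A,3B}\,\mathrm{CNOT}^{3A}_{2A}\,\mathrm{CNOT}^{3B}_{2B}\,\hat R_{2A,3A}\,\hat R^\dagger_{2B,3B},$$ $$\hat P^i=\hat O^i\,\mathrm{SWAP}^{2A}_{1A}\,\mathrm{SWAP}^{2B}_{1B},$$ $$\hat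 F^j=\langle j|_{2A,2B}\,\mathrm{CNOT}^{2A}_{1A}\,\mathrm{CNOT}^{2B}_{1B}\,\hat R_{1A,2A}\,\hat R^\dagger_{1B,2B}.$$ Thus $\hat O^i,\hat P^i$ map the space of pairs $1,2,3$ to that of pairs $1,2$, and $\hat F^j$ maps the space of pairs $1,2$ to that of pair $1$. The operator $\hat Q_1$ removes pair $2$ and acts as the identity on pair $1$ if that pair is present; $\hat Q_2$ removes pair $1$ and acts as the identity on pair $2$ if that pair is present. Hence both compositions $\hat Q_2\hat Q_1$ and $\hat Q_1\hat Q_2$ map the space of pairs $1,2,3$ to that of pair $3$. ''Up to SWAP gates'' means: $\mathrm{SWAP}^{3A}_{2A}\mathrm{SWAP}^{3B}_{2B}$ followed by $\langle00|_{2A,2B}$ equals $\langle00|_{3A,3B}$ followed by relabelling the surviving pair $2$ as pair $3$, and similarly with pair $1$ in place of pair $2$. *)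

(* Defs.v *)
From HB Require Import structures.
From mathcomp Require Import all_boot all_order all_algebra.
From mathcomp Require Import all_classical all_reals all_analysis.
From mathcomp Require Import complex mxtens.

Set Implicit Arguments.
Unset Strict Implicit.
Unset Printing Implicit Defensive.

Import Order.TTheory GRing.Theory Num.Theory numFieldNormedType.Exports.

Local Open Scope classical_set_scope.
Local Open Scope ring_scope.
Local Open Scope complex_scope.
Local Open Scope sesquilinear_scope.

(* Limit of the exponential series in the entrywise topology of 'M[K]_n.+1. *)
Definition expmx (K : numFieldType) (n : nat) (M : 'M[K]_n.+1) : 'M[K]_n.+1 :=
  lim (series (fun k : nat => (k`!%:R)^-1 *: M ^+ k) @ \oo).

(* A register is the list of the qubit pairs that are present, each pair being
   named by a number; the qubits of pair x are (x, alice) and (x, bob).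
   Removing a pair from a concrete register computes, so for instance
   [rmpair 2 (rmpair 1 [:: 1; 2; 3])], [rmpair 1 (rmpair 2 [:: 1; 2; 3])] and
   [[:: 3]] are convertible. *)
Definition register := seq nat.
Definition qubit := (nat * bool)%type.
Definition alice : bool := false.
Definition bob : bool := true.

Definition rmpair (x : nat) (s : register) : register :=
  [seq z <- s | z != x].

(* Labels of the computational basis of the space of a register, and operators
   from the space of s to that of t, as matrices in these bases acting on
   column vectors. *)
Definition basis (s : register) := {ffun seq_sub s * bool -> 'I_2}.

Definition op (R : realType) (s t : register) :=
  'M[R[i]]_(#|{: basis t}|, #|{: basis s}|).

(* The operator whose matrix entry <c|M|b> is f c b. *)
Definition mkop (R : realType) (s t : register)
    (f : basis t -> basis s -> R[i]) : op R s t :=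
  \matrix_(i, j) f (enum_val i) (enum_val j).

(* The value of qubit q in a basis label; the default value 0 for a qubit
   which is not in the register is never used below. *)
Definition bit (s : register) (b : basis s) (q : qubit) : 'I_2 :=
  if insub q.1 is Some x then b (x, q.2) else 0.

(* c is the basis label with values f on its own qubits. *)
Definition has_bits (s : register) (c : basis s) (f : qubit -> 'I_2) : bool :=
  [forall q : seq_sub s * bool, c q == f (val q.1, q.2)].

Section Gates.
Variable R : realType.
Local Notation C := (R[i]).

Definition pauliX : 'M[C]_2 := \matrix_(i, j) (i != j)%:R.

Definition Rgate : 'M[C]_2 := expmx (- ('i * (pi / 4)%:C) *: pauliX).

(* The one-qubit operator U on qubit u, identity on all the other qubits. *)
Definition gate1 (U : 'M[C]_2) (u : qubit) (s : register) : op R s s :=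
  mkop (fun c b => U (bit c u) (bit b u) *
    (has_bits c (fun q => if q == u then bit c u else bit b q))%:R).

Definition Rpair (u v : qubit) (s : register) : op R s s :=
  gate1 Rgate u s *m gate1 Rgate v s.

Definition Rdagpair (u v : qubit) (s : register) : op R s s :=
  gate1 (Rgate ^t*) u s *m gate1 (Rgate ^t*) v s.

(* Control u, target v; the addition of 'I_2 is addition modulo 2. *)
Definition CNOT (u v : qubit) (s : register) : op R s s :=
  mkop (fun c b =>
    (has_bits c (fun q => if q == v then bit b v + bit b u else bit b q))%:R).

Definition SWAP (u v : qubit) (s : register) : op R s s :=
  mkop (fun c b =>
    (has_bits c (fun q => if q == u then bit b v
                          else if q == v then bit b u else bit b q))%:R).

(* Partial inner product with |ab> on pair y. *)
Definition bra (y : nat) (ab : 'I_2 * 'I_2) (s : register) :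
    op R s (rmpair y s) :=
  mkop (fun c b =>
    ((bit b (y, alice) == ab.1) && (bit b (y, bob) == ab.2)
      && has_bits c (bit b))%:R).

(* Renaming of pair x as pair y, on the register s minus y. *)
Definition relabel (x y : nat) (s : register) :
    op R (rmpair y s) (rmpair x s) :=
  mkop (fun c b =>
    (has_bits c (fun q => bit b (if q.1 == y then x else q.1, q.2)))%:R).

Definition bilocal (x y : nat) (s : register) : op R s s :=
  CNOT (x, alice) (y, alice) s *m CNOT (x, bob) (y, bob) s
    *m Rpair (x, alice) (y, alice) s *m Rdagpair (x, bob) (y, bob) s.

Definition swap_pairs (x y : nat) (s : register) : op R s s :=
  SWAP (x, alice) (y, alice) s *m SWAP (x, bob) (y, bob) s.

Definition opO (i : 'I_2 * 'I_2) : op R [:: 1; 2; 3]%N [:: 1; 2]%N :=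
  bra 3 i [:: 1; 2; 3]%N *m bilocal 2 3 [:: 1; 2; 3]%N.

Definition opP (i : 'I_2 * 'I_2) : op R [:: 1; 2; 3]%N [:: 1; 2]%N :=
  opO i *m swap_pairs 1 2 [:: 1; 2; 3]%N.

Definition opF (j : 'I_2 * 'I_2) : op R [:: 1; 2]%N [:: 1]%N :=
  bra 2 j [:: 1; 2]%N *m bilocal 1 2 [:: 1; 2]%N.

Definition opQ1 (s : register) : op R s (rmpair 2 s) :=
  sqrtC 2 *: (bra 2 (0, 0) s *m swap_pairs 2 3 s *m bilocal 2 3 s).

Definition opQ2 (s : register) : op R s (rmpair 1 s) :=
  sqrtC 2 *: (bra 1 (0, 0) s *m swap_pairs 1 3 s *m bilocal 1 3 s).

(* The DEJMPS step with kept pair x and measured pair y, projecting only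
   onto |00>. *)
Definition dejmps00 (x y : nat) (s : register) : op R s (rmpair y s) :=
  sqrtC 2 *: (bra y (0, 0) s *m bilocal x y s).

Definition ket2 (a b : 'I_2) : 'cV[C]_(2 * 2) :=
  (delta_mx a 0 : 'cV[C]_2) *t (delta_mx b 0 : 'cV[C]_2).

Definition PhiP : 'cV[C]_(2 * 2) := (sqrtC 2)^-1 *: (ket2 0 0 + ket2 1 1).
Definition PhiM : 'cV[C]_(2 * 2) := (sqrtC 2)^-1 *: (ket2 0 0 - ket2 1 1).
Definition PsiP : 'cV[C]_(2 * 2) := (sqrtC 2)^-1 *: (ket2 0 1 + ket2 1 0).
Definition PsiM : 'cV[C]_(2 * 2) := (sqrtC 2)^-1 *: (ket2 0 1 - ket2 1 0).

Definition bell_diagonal (a b c d : R) : 'M[C]_(2 * 2) :=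
  a%:C *: (PhiP *m PhiP ^t*) + b%:C *: (PsiM *m PsiM ^t*)
  + c%:C *: (PsiP *m PsiP ^t*) + d%:C *: (PhiM *m PhiM ^t*).

(* The tensor product, over the pairs x of s, of chi x, whose matrix is taken
   in the product basis |ab> with a Alice's bit and b Bob's bit. *)
Definition tensor_state (s : register) (chi : nat -> 'M[C]_(2 * 2)) :
    op R s s :=
  mkop (fun c b => \prod_(x : seq_sub s)
    chi (val x) (mxtens_index (c (x, alice), c (x, bob)))
                (mxtens_index (b (x, alice), b (x, bob)))).

End Gates.

Definition outcomes : seq ('I_2 * 'I_2) := [:: (0, 0); (1, 1)].

(* Main.v *)
(* The Kraus operators F^j O^i and F^j P^i differ from F^00 O^00 and F^00 P^00 by
   Pauli operators XX on some pairs: <11| = <00| XX, and XX can be pulled back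
   through the CNOT and R gates. Bell-diagonal states commute with all products
   of XX and ZZ, so in every term of the four sums the Pauli operators of the two
   sides meet. In N1 and N2 they cancel. In M1 and M2 what is left for j = 11 is
   XX on pairs 1 and 2, and it is absorbed too: <00| is fixed by ZZ, and pulling
   the ZZ of the second step back to the input shows that F^00 O^00 is fixed by
   XX1 ZZ1 ZZ2 XX3 and F^00 P^00 by ZZ1 XX2 ZZ2 XX3, whose product is XX1 XX2.
   So the four terms of each sum are equal; their number 4 = (sqrt 2)^4 accounts
   for the normalization of Q1 and Q2, since Q2 Q1 = 2 F^00 O^00 and
   Q1 Q2 = 2 F^00 P^00 up to the name of the surviving pair. *)
Require Import Defs.
From HB Require Import structures.
From mathcomp Require Import all_boot all_order all_algebra.
From mathcomp Require Import all_classical all_reals all_analysis.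
From mathcomp Require Import complex mxtens.
From mathcomp Require Import ring.

Set Implicit Arguments.
Unset Strict Implicit.
Unset Printing Implicit Defensive.

Import Order.TTheory GRing.Theory Num.Theory numFieldNormedType.Exports.

Local Open Scope ring_scope.
Local Open Scope complex_scope.
Local Open Scope sesquilinear_scope.

(** * The rotation gate as an explicit matrix *)

Lemma cvg_real_complex (R : realType) (K := R[i] : numFieldType) (u : nat -> R) (l : R) :
  (u @ \oo --> l)%classic -> ((fun n => (u n)%:C : K) @ \oo --> (l%:C : K))%classic.
Proof.
move=> ul; apply/(@cvgrPdist_lt K K^o) => /= e e0.
(* A positive element of [R[i]] is real, because the order compares only numbers with equal
   imaginary parts. *)
have [r r0 ->] : exists2 r : R, 0 < r & e = r%:C.
  by move: e0; rewrite ltcE /= => /andP[/eqP]; case: (e) => a b /= ->; exists a.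
move: ul => /cvgrPdist_lt /(_ _ r0) ul.
near=> n.
have -> : l%:C - (u n)%:C = (l - u n)%:C by rewrite rmorphB.
rewrite normc_def /= expr0n addr0 sqrtr_sqr ltcR.
by near: n.
Unshelve. all: by end_near. Qed.

(** Powers of an involution alternate between 1 and [X], so the exponential series splits into the
    cosine series times 1 and the sine series times [X]. Each of these converges because the real
    series does. *)
Lemma expmx_involution (R : realType) (n : nat) (X : 'M[R[i]]_n.+1) (t : R) :
  X ^+ 2 = 1 ->
  expmx (- ('i * t%:C) *: X) = (cos t)%:C *: 1 - ('i * (sin t)%:C) *: X.
Proof.
move=> X2; pose K : numFieldType := R[i].
have XE k : X ^+ k = if odd k then X else 1.
  rewrite -{1}(odd_double_half k) exprD -mul2n exprM X2 expr1n mulr1.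
  by case: odd; rewrite ?expr1 ?expr0.
have termE k : (k`!%:R)^-1 *: (- ('i * t%:C) *: X) ^+ k =
    (cos_coeff t k)%:C *: 1 - ('i * (sin_coeff t k)%:C) *: X :> 'M[K]_n.+1.
  have iE : (- ('i * t%:C)) ^+ k =
    (-1) ^+ k./2 * (if odd k then - 'i else 1) * t%:C ^+ k :> R[i].
    rewrite -mulNr exprMn -{1}(odd_double_half k) exprD -mul2n exprM sqrrN sqrCi.
    by rewrite [RHS]mulrAC mulrC; case: odd; rewrite ?expr1 ?expr0; ring.
  rewrite exprZn XE scalerA iE /cos_coeff /sin_coeff.
  rewrite !(rmorphM, rmorphXn, fmorphV, rmorph_nat, rmorphN, rmorph1) /=.
  case: ifP => ok.
    rewrite !mul0r scale0r add0r mul1r -scaleNr; congr (_ *: _).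
    (* [sin_coeff] carries the exponent [k.-1./2], which agrees with [k./2] for odd [k]. *)
    have -> : k.-1./2 = k./2.
      by move: ok; case: (k) => //= m /negPf om; rewrite uphalf_half om.
    by ring.
  by rewrite !mul0r mulr0 scale0r subr0 mul1r; congr (_ *: _); ring.
rewrite /expmx; apply: cvg_lim; first exact: norm_hausdorff.
rewrite [X in (X @ _)%classic](_ : _ = (fun k =>
   (series (cos_coeff t) k)%:C *: (1 : 'M[K]_n.+1)
   - ('i * (series (sin_coeff t) k)%:C) *: (X : 'M[K]_n.+1))); last first.
  apply/funext => k; rewrite /series /= (eq_bigr _ (fun k _ => termE k)).
  by rewrite sumrB -!scaler_suml -mulr_sumr !rmorph_sum.
apply: (@cvgB K 'M[K]_n.+1).
  apply: (@cvgZ K 'M[K]_n.+1); last exact: cvg_cst.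
  by apply: cvg_real_complex; rewrite unlock; exact: is_cvg_series_cos_coeff.
apply: (@cvgZ K 'M[K]_n.+1); last exact: cvg_cst.
apply: (@cvgM K); first exact: cvg_cst.
by apply: cvg_real_complex; rewrite unlock; exact: is_cvg_series_sin_coeff.
Qed.

Lemma ord2_ind (P : 'I_2 -> Prop) : P 0 -> P 1 -> forall a, P a.
Proof.
move=> P0 P1 [[|[|//]] a2]; first by rewrite (_ : Ordinal a2 = 0) //; apply/val_inj.
by rewrite (_ : Ordinal a2 = 1) //; apply/val_inj.
Qed.

Lemma sum_ord2 (V : nmodType) (F : 'I_2 -> V) : \sum_a F a = F 0 + F 1.
Proof.
by rewrite !big_ord_recl big_ord0 addr0; congr (_ + F _); apply/val_inj.
Qed.

Lemma ord2_addbb : 1 + 1 = 0 :> 'I_2.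
Proof. exact/val_inj. Qed.

(** At pi/4 sine and cosine coincide. Their common value stays a scalar factor, since the later
    identities hold for any such factor. *)
Lemma RgateE (R : realType) (a b : 'I_2) :
  Rgate R a b = (cos (pi / 4))%:C * (if a == b then 1 else - 'i).
Proof.
have X2 : pauliX R ^+ 2 = 1.
  apply/matrixP => i j; rewrite expr2 !mxE !big_ord_recl big_ord0 !mxE.
  by elim/ord2_ind: i; elim/ord2_ind: j => /=; ring.
have sin_cos : sin (pi / 4) = cos (pi / 4) :> R.
  rewrite -cosBpihalf -cosN; congr cos.
  by field.
rewrite /Rgate expmx_involution // sin_cos !mxE.
by case: eqP => _ /=; ring.
Qed.

Lemma RgatedagE (R : realType) (a b : 'I_2) :
  (Rgate R)^t* a b = (cos (pi / 4))%:C * (if a == b then 1 else 'i).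
Proof.
rewrite !mxE RgateE rmorphM /= eq_sym; congr (_ * _); first exact: conjc_real.
by case: eqP => _; rewrite ?rmorph1 // rmorphN /=; rewrite [X in - X](@conjCi R[i]) opprK.
Qed.

(** * Composition of operators given by their matrix entries *)

Section BasisCalculus.
Variable R : realType.
Local Notation C := R[i].
Local Notation basis := Defs.basis.
Implicit Types (s t : register) (q : qubit).

(** Labels come from functions on all qubits, so that one function describes labels of different
    registers, for instance before and after a pair is removed. *)
Definition mk s (phi : qubit -> 'I_2) : basis s :=
  [ffun q => phi (val q.1, q.2)].

Lemma bit_mk s phi q : q.1 \in s -> bit (mk s phi) q = phi q.
Proof. by case: q => x h /= xs; rewrite /bit insubT /= ffunE. Qed.

Lemma has_bitsE s (c : basis s) phi : has_bits c phi = (c == mk s phi).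
Proof.
apply/forallP/eqP => [cE|-> q]; last by rewrite ffunE.
by apply/ffunP => q; rewrite ffunE; apply/eqP.
Qed.

Lemma eq_mk s phi psi :
  (forall q, q.1 \in s -> phi q = psi q) -> mk s phi = mk s psi.
Proof. by move=> e; apply/ffunP => -[x h]; rewrite !ffunE e //; apply: valP. Qed.

Lemma mk_bit s (b : basis s) : mk s (bit b) = b.
Proof.
apply/ffunP => -[x h]; rewrite ffunE /bit /= insubT /=; first exact: valP.
by move=> xs; congr (b (_, _)); apply/val_inj.
Qed.

Lemma eq_mkop s t (f g : basis t -> basis s -> C) : f =2 g -> mkop f = mkop g.
Proof. by move=> e; apply/matrixP => i j; rewrite !mxE. Qed.

Lemma mulmx_mkop s t u (g : basis u -> basis t -> C) (f : basis t -> basis s -> C) :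
  mkop g *m mkop f = mkop (fun c b => \sum_d g c d * f d b).
Proof.
apply/matrixP => i j; rewrite !mxE (reindex (@enum_rank (basis t))) /=.
  by apply: eq_bigr => d _; rewrite !mxE enum_rankK.
by exists enum_val => x _; rewrite ?enum_rankK ?enum_valK.
Qed.

(** [CNOT], [SWAP], [relabel] and [bra] send each basis vector to a basis vector or to zero.
    Composing with them on the right is therefore a substitution, with no sum over intermediate
    labels. *)
Lemma mulmx_partial_fun s t u (g : basis u -> basis t -> C) (P : pred (basis s)) phi :
  mkop g *m mkop (fun c b => (P b && has_bits c (phi b))%:R) =
  mkop (fun c b => (P b)%:R * g c (mk t (phi b))).
Proof.
rewrite mulmx_mkop; apply: eq_mkop => c b.
rewrite (bigD1 (mk t (phi b))) //= has_bitsE eqxx andbT big1 ?addr0 1?mulrC //.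
by move=> d /negPf nd; rewrite has_bitsE nd andbF mulr0.
Qed.

Lemma mulmx_fun s t u (g : basis u -> basis t -> C) phi :
  mkop g *m mkop (fun c (b : basis s) => (has_bits c (phi b))%:R) =
  mkop (fun c b => g c (mk t (phi b))).
Proof.
rewrite (mulmx_partial_fun g xpredT); apply: eq_mkop => c b; exact: mul1r.
Qed.

Definition upd s (b : basis s) q (a : 'I_2) : basis s :=
  mk s (fun q' => if q' == q then a else bit b q').

Lemma mulmx_gate1 s u (g : basis u -> basis s -> C) U q : q.1 \in s ->
  mkop g *m gate1 U q s =
  mkop (fun c b => \sum_a U a (bit b q) * g c (upd b q a)).
Proof.
move=> qs; rewrite mulmx_mkop; apply: eq_mkop => c b.
(* Intermediate labels are grouped by their bit at [q]; in each group only [upd b q a] has a nonzero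
   entry. *)
rewrite (partition_big (fun d => bit d q) xpredT) //=.
apply: eq_bigr => a _; rewrite (bigD1 (upd b q a)) /=; last first.
  by rewrite bit_mk // eqxx.
rewrite has_bitsE big1 => [|d /andP[/eqP <- /negPf nd]]; last first.
  by rewrite has_bitsE nd mulr0n !mulr0.
by rewrite bit_mk // eqxx -/(upd b q a) eqxx addr0 mulr1 mulrC.
Qed.

(* Here a and a' are the bits of pair x after the R gates; the CNOT gates and the
   projection then force the bits a + i.1 and a' + i.2 on pair y. *)
Definition pull_bilocal s u x y (i : 'I_2 * 'I_2) (g : basis u -> basis (rmpair y s) -> C)
    (c : basis u) (b : basis s) : C :=
  \sum_a \sum_a'
    Rgate R a (bit b (x, alice)) * Rgate R (a + i.1) (bit b (y, alice)) *
    ((Rgate R)^t* a' (bit b (x, bob)) * (Rgate R)^t* (a' + i.2) (bit b (y, bob))) *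
    g c (mk (rmpair y s) (fun q =>
      if q == (x, alice) then a else if q == (x, bob) then a' else bit b q)).

Lemma mem_rmpair x y s : (x \in rmpair y s) = (x != y) && (x \in s).
Proof. by rewrite mem_filter. Qed.

Lemma bit_upd s (b : basis s) q a q' :
  q'.1 \in s -> bit (upd b q a) q' = if q' == q then a else bit b q'.
Proof. exact: bit_mk. Qed.

Lemma alice_bobE (x : nat) :
  (((x, alice) == (x, bob)) = false) * (((x, bob) == (x, alice)) = false).
Proof. by rewrite !xpair_eqE !andbF. Qed.

Lemma mulmx_bra_CNOT s u x y i (g : basis u -> basis (rmpair y s) -> C) :
  x != y -> x \in s -> y \in s ->
  mkop g *m bra R y i s *m CNOT R (x, alice) (y, alice) s
    *m CNOT R (x, bob) (y, bob) s =
  mkop (fun c b => ((bit b (y, alice) + bit b (x, alice) == i.1) &&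
                    (bit b (y, bob) + bit b (x, bob) == i.2))%:R *
                   g c (mk (rmpair y s) (bit b))).
Proof.
move=> nxy xs ys; have xyE h k : ((x, h) == (y, k)) = false by rewrite xpair_eqE (negPf nxy).
rewrite mulmx_partial_fun !mulmx_fun; apply: eq_mkop => c b.
congr (_%:R * g c _).
  by rewrite !bit_mk // ?xyE ?eqxx ?alice_bobE ?bit_mk // ?xyE ?eqxx ?alice_bobE.
apply: eq_mk => q; rewrite mem_rmpair => /andP[/negPf ny qs].
by rewrite !bit_mk // /eq_op /= ny.
Qed.

Lemma mulmx_bilocal s u x y i (g : basis u -> basis (rmpair y s) -> C) :
  x != y -> x \in s -> y \in s ->
  mkop g *m (bra R y i s *m bilocal R x y s) = mkop (pull_bilocal x i g).
Proof.
move=> nxy xs ys; rewrite !mulmxA mulmx_bra_CNOT // !mulmx_gate1 //.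
have xyE h k : ((x, h) == (y, k)) = false by rewrite xpair_eqE (negPf nxy).
have yxE h k : ((y, h) == (x, k)) = false by rewrite eq_sym xyE.
apply: eq_mkop => c b; rewrite /pull_bilocal.
pose F a a' := g c (mk (rmpair y s) (fun q =>
  if q == (x, alice) then a else if q == (x, bob) then a' else bit b q)).
(* The variables [e], [a'], [f], [a] are the bits of Bob's [y], Bob's [x], Alice's [y] and Alice's
   [x] after the R gates, in the order in which the gates unfold. The parity test then determines
   [e] and [f]. *)
transitivity (\sum_e (Rgate R)^t* e (bit b (y, bob)) *
  \sum_a' (Rgate R)^t* a' (bit b (x, bob)) *
  \sum_f Rgate R f (bit b (y, alice)) *
  \sum_a Rgate R a (bit b (x, alice)) *
    (((f + a == i.1) && (e + a' == i.2))%:R * F a a')).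
  apply: eq_bigr => e _; congr (_ * _).
  do 3!(apply: eq_bigr => ? _; congr (_ * _);
    first by rewrite ?bit_upd // ?(xyE, yxE, alice_bobE)).
  rewrite !bit_upd // ?(xyE, yxE, alice_bobE) !eqxx.
  congr (_ * g c _); apply: eq_mk => q; rewrite mem_rmpair => /andP[/negPf ny qs].
  by rewrite !bit_upd // /eq_op /= ny.
rewrite !sum_ord2 -!/(F _ _); case: i => i i' /=.
by elim/ord2_ind: i; elim/ord2_ind: i'; rewrite ?addr0 ?add0r ?ord2_addbb /=; ring.
Qed.

Lemma eq_has_bits s (c : basis s) phi psi :
  (forall q, q.1 \in s -> phi q = psi q) -> has_bits c phi = has_bits c psi.
Proof. by move=> e; rewrite !has_bitsE (eq_mk e). Qed.

Lemma eq_basis s (b c : basis s) :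
  (forall q, q.1 \in s -> bit b q = bit c q) -> b = c.
Proof. by move=> e; rewrite -[b]mk_bit -[c]mk_bit; exact: eq_mk. Qed.

Lemma mkop_id s : mkop (fun c b : basis s => (c == b)%:R) = 1%:M :> op R s s.
Proof. by apply/matrixP => i j; rewrite !mxE (inj_eq enum_val_inj). Qed.

Definition swapq (x y : nat) q : qubit :=
  (if q.1 == x then y else if q.1 == y then x else q.1, q.2).

Lemma mulmx_swap_pairs s u x y (g : basis u -> basis s -> C) :
  x \in s -> y \in s ->
  mkop g *m swap_pairs R x y s =
  mkop (fun c b => g c (mk s (fun q => bit b (swapq x y q)))).
Proof.
move=> xs ys; rewrite mulmxA /SWAP !mulmx_fun; apply: eq_mkop => c b.
congr (g c _); apply: eq_mk => -[z h] /= zs; rewrite !bit_mk // /swapq !xpair_eqE /=.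
by case: h; rewrite /= ?andbT ?andbF /=; case: (z == x) => //; case: (z == y).
Qed.

(** After the exchange the name [x] denotes the old pair [y]. Projecting [x] thus measures the old
    [y] and leaves the old [x] under the name [y]. *)
Lemma bra_swap_pairs s x y i : x != y -> x \in s -> y \in s ->
  bra R x i s *m swap_pairs R x y s = relabel R x y s *m bra R y i s.
Proof.
move=> nxy xs ys; rewrite mulmx_swap_pairs // /relabel mulmx_partial_fun.
apply: eq_mkop => c b; rewrite -natrM mulnb !bit_mk // /swapq /= eqxx.
congr ((_ && _)%:R); apply: eq_has_bits => -[z h].
rewrite mem_rmpair /= => /andP[/negPf zx zs].
rewrite bit_mk //= [RHS]bit_mk ?zx //= mem_rmpair.
by case: ifPn => [_|->]; rewrite ?nxy.
Qed.

(** Relabelling is a bijection on basis labels, so on the left it also acts by substitution, with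
    the inverse renaming. *)
Lemma mulmx_relabel s u x y (g : basis (rmpair y s) -> basis u -> C) :
  x != y -> x \in s -> y \in s ->
  relabel R x y s *m mkop g =
  mkop (fun c b => g (mk (rmpair y s)
    (fun q => bit c (if q.1 == x then y else q.1, q.2))) b).
Proof.
move=> nxy xs ys; rewrite mulmx_mkop; apply: eq_mkop => c b.
have nyx : y != x by rewrite eq_sym.
set d0 := mk _ _; rewrite (bigD1 d0) //= big1 => [|d /eqP nd].
  rewrite addr0 has_bitsE (_ : _ == _) ?mul1r //; apply/eqP/eq_basis => -[z h] /=.
  rewrite mem_rmpair => /andP[zx zs]; rewrite bit_mk ?mem_rmpair ?zx //=.
  rewrite bit_mk /=; last by rewrite mem_rmpair; case: (eqVneq z y) => zy; rewrite ?nxy ?zy.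
  by case: (eqVneq z y) => [->|zy]; rewrite ?eqxx // (negPf zx).
rewrite has_bitsE (_ : _ == _ = false) ?mul0r //; apply/eqP => cE; apply: nd.
apply: eq_basis => -[z h] /=; rewrite mem_rmpair => /andP[zy zs].
rewrite /d0 bit_mk ?mem_rmpair ?zy //= cE bit_mk /=.
  by case: (eqVneq z x) => [->|zx]; rewrite ?eqxx // (negPf zy).
by rewrite mem_rmpair; case: (eqVneq z x) => zx; rewrite ?nyx ?zx.
Qed.

Lemma opQ1E s : 2%N \in s -> 3%N \in s ->
  opQ1 R s = relabel R 2 3 s *m dejmps00 R 2 3 s.
Proof. by move=> ? ?; rewrite /opQ1 /dejmps00 bra_swap_pairs // -scalemxAr -mulmxA. Qed.

Lemma opQ2E s : 1%N \in s -> 3%N \in s ->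
  opQ2 R s = relabel R 1 3 s *m dejmps00 R 1 3 s.
Proof. by move=> ? ?; rewrite /opQ2 /dejmps00 bra_swap_pairs // -scalemxAr -mulmxA. Qed.

(** When [x] is the only pair left, the output label fixes both summation bits, and the entry of a
    DEJMPS step becomes a product of four gate entries. *)
Lemma pull_bilocal_id s x y i (c : basis (rmpair y s)) (b : basis s) :
  x \in rmpair y s -> {in rmpair y s, forall z, z = x} ->
  pull_bilocal x i (fun c b => (c == b)%:R) c b =
  Rgate R (bit c (x, alice)) (bit b (x, alice)) *
  Rgate R (bit c (x, alice) + i.1) (bit b (y, alice)) *
  ((Rgate R)^t* (bit c (x, bob)) (bit b (x, bob)) *
   (Rgate R)^t* (bit c (x, bob) + i.2) (bit b (y, bob))).
Proof.
move=> xs sx; rewrite /pull_bilocal.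
have cE a a' : (c == mk (rmpair y s) (fun q => if q == (x, alice) then a
      else if q == (x, bob) then a' else bit b q)) =
    (bit c (x, alice) == a) && (bit c (x, bob) == a').
  apply/eqP/andP => [->|[/eqP <- /eqP <-]].
    by rewrite !bit_mk // !eqxx !alice_bobE.
  apply: eq_basis => -[z h] /= /sx ->; rewrite bit_mk //.
  by case: h; rewrite ?eqxx // alice_bobE.
under eq_bigr => a _ do under eq_bigr => a' _ do rewrite cE.
elim/ord2_ind: (bit c (x, alice)); elim/ord2_ind: (bit c (x, bob));
  by rewrite !sum_ord2 /=; ring.
Qed.

End BasisCalculus.

(** * Closed forms of the two-step Kraus operators *)

Section ClosedForms.
Variable R : realType.
Local Notation C := R[i].
Local Notation basis := Defs.basis.
Implicit Types (s t : register) (q : qubit).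

Lemma mulmx_opF u j (g : basis u -> basis [:: 1%N] -> C) :
  mkop g *m opF R j = mkop (@pull_bilocal R [:: 1; 2]%N u 1 2 j g).
Proof. exact: (@mulmx_bilocal R [:: 1; 2]%N u 1 2 j g). Qed.

Lemma mulmx_opO u i (g : basis u -> basis [:: 1; 2]%N -> C) :
  mkop g *m opO R i = mkop (@pull_bilocal R [:: 1; 2; 3]%N u 2 3 i g).
Proof. exact: (@mulmx_bilocal R [:: 1; 2; 3]%N u 2 3 i g). Qed.

Lemma opFE j : opF R j = mkop (fun (c : basis [:: 1%N]) (b : basis [:: 1; 2]%N) =>
  Rgate R (bit c (1%N, alice)) (bit b (1%N, alice)) *
  Rgate R (bit c (1%N, alice) + j.1) (bit b (2%N, alice)) *
  ((Rgate R)^t* (bit c (1%N, bob)) (bit b (1%N, bob)) *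
   (Rgate R)^t* (bit c (1%N, bob) + j.2) (bit b (2%N, bob)))).
Proof.
rewrite -[LHS]mul1mx -mkop_id mulmx_opF; apply: eq_mkop => c b.
by apply: (@pull_bilocal_id R [:: 1; 2]%N 1 2) => // z; rewrite inE => /eqP.
Qed.

(* One party's factor of <c|F^j O^i|b1 b2 b3>: Alice's for U = R, Bob's for
   U = R^dagger; j and i are that party's measured bits. *)
Definition amp (U : 'M[C]_2) (j i c b1 b2 b3 : 'I_2) : C :=
  U c b1 * \sum_a U (c + j) a * (U a b2 * U (a + i) b3).

(** Each gate acts within one party and each projection is onto a product vector, so the double sum
    over Alice's and Bob's bits factors. *)
Lemma opFOE j i : opF R j *m opO R i =
  mkop (fun (c : basis [:: 1%N]) (b : basis [:: 1; 2; 3]%N) =>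
    amp (Rgate R) j.1 i.1 (bit c (1%N, alice))
      (bit b (1%N, alice)) (bit b (2%N, alice)) (bit b (3%N, alice)) *
    amp ((Rgate R)^t*) j.2 i.2 (bit c (1%N, bob))
      (bit b (1%N, bob)) (bit b (2%N, bob)) (bit b (3%N, bob))).
Proof.
rewrite opFE mulmx_opO.
apply: eq_mkop => c b; rewrite /pull_bilocal /amp !sum_ord2 !bit_mk //=.
by ring.
Qed.

Lemma opFPE j i : opF R j *m opP R i =
  mkop (fun (c : basis [:: 1%N]) (b : basis [:: 1; 2; 3]%N) =>
    amp (Rgate R) j.1 i.1 (bit c (1%N, alice))
      (bit b (2%N, alice)) (bit b (1%N, alice)) (bit b (3%N, alice)) *
    amp ((Rgate R)^t*) j.2 i.2 (bit c (1%N, bob))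
      (bit b (2%N, bob)) (bit b (1%N, bob)) (bit b (3%N, bob))).
Proof.
rewrite /opP mulmxA opFOE mulmx_swap_pairs //.
by apply: eq_mkop => c b; rewrite !bit_mk.
Qed.

Lemma sqrtC2_sqr : sqrtC 2 * sqrtC 2 = 2 :> C.
Proof. by rewrite -expr2 sqrtCK. Qed.

Lemma opQ21E : opQ2 R [:: 1; 3]%N *m opQ1 R [:: 1; 2; 3]%N =
  2 *: ((relabel R 1 3 [:: 1; 3]%N : op R [:: 1%N] [:: 3%N]) *m
        (opF R (0, 0) *m opO R (0, 0))).
Proof.
(* The survivor of the first step is pair 2 renamed as 3, so measuring pair 3 in the second step is
   the measurement of pair 2 in [opF]. *)
have FE : (bra R 3 (0, 0) [:: 1; 3]%N *m bilocal R 1 3 [:: 1; 3]%N : op R _ [:: 1%N])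
    *m (relabel R 2 3 [:: 1; 2; 3]%N : op R [:: 1; 2]%N [:: 1; 3]%N) = opF R (0, 0).
  rewrite opFE -[X in X *m _]mul1mx -mkop_id.
  rewrite (@mulmx_bilocal R [:: 1; 3]%N [:: 1%N] 1 3) // /relabel mulmx_fun.
  apply: eq_mkop => c b; rewrite (@pull_bilocal_id R [:: 1; 3]%N 1 3) //.
    by rewrite !bit_mk.
  by move=> z; rewrite inE => /eqP.
rewrite opQ1E // opQ2E // /dejmps00 -!scalemxAr -!scalemxAl scalerA sqrtC2_sqr.
by rewrite -FE -(mulmxA (relabel R 1 3 _)); congr (_ *: (_ *m _)); rewrite mulmxA.
Qed.

(** Here the pair that survives both steps is pair 2, whereas [opF] leaves pair 1. The inner
    operators thus have different codomains, and the two sides are compared by entries after each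
    has been relabelled to pair 3. *)
Lemma opQ12E : opQ1 R [:: 2; 3]%N *m opQ2 R [:: 1; 2; 3]%N =
  2 *: ((relabel R 1 3 [:: 1; 3]%N : op R [:: 1%N] [:: 3%N]) *m
        (opF R (0, 0) *m opP R (0, 0))).
Proof.
rewrite opQ1E // opQ2E // /dejmps00 -!scalemxAr -!scalemxAl scalerA sqrtC2_sqr.
have FE : (bra R 3 (0, 0) [:: 2; 3]%N *m bilocal R 2 3 [:: 2; 3]%N : op R _ [:: 2%N])
    *m (relabel R 1 3 [:: 1; 2; 3]%N : op R [:: 1; 2]%N [:: 2; 3]%N) =
    mkop (fun (c : basis [:: 2%N]) (b : basis [:: 1; 2]%N) =>
      Rgate R (bit c (2%N, alice)) (bit b (2%N, alice)) *
      Rgate R (bit c (2%N, alice)) (bit b (1%N, alice)) *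
      ((Rgate R)^t* (bit c (2%N, bob)) (bit b (2%N, bob)) *
       (Rgate R)^t* (bit c (2%N, bob)) (bit b (1%N, bob)))).
  rewrite -[X in X *m _]mul1mx -mkop_id.
  rewrite (@mulmx_bilocal R [:: 2; 3]%N [:: 2%N] 2 3) // /relabel mulmx_fun.
  apply: eq_mkop => c b; rewrite (@pull_bilocal_id R [:: 2; 3]%N 2 3) //.
    by rewrite !bit_mk // !addr0.
  by move=> z; rewrite inE => /eqP.
rewrite opFPE; congr (_ *: _).
rewrite (@mulmx_relabel R [:: 1; 3]%N [:: 1; 2; 3]%N 1 3) //.
(* These are the entries of [opFPE] for outcome 00, with the surviving pair named 2. *)
transitivity ((relabel R 2 3 [:: 2; 3]%N : op R [:: 2%N] [:: 3%N]) *m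
  mkop (fun (c : basis [:: 2%N]) (b : basis [:: 1; 2; 3]%N) =>
    amp (Rgate R) 0 0 (bit c (2%N, alice))
      (bit b (2%N, alice)) (bit b (1%N, alice)) (bit b (3%N, alice)) *
    amp ((Rgate R)^t*) 0 0 (bit c (2%N, bob))
      (bit b (2%N, bob)) (bit b (1%N, bob)) (bit b (3%N, bob)))).
  rewrite -(mulmxA (relabel R 2 3 _)); congr (_ *m _); rewrite mulmxA FE.
  rewrite (@mulmx_bilocal R [:: 1; 2; 3]%N [:: 2%N] 1 3) //.
  apply: eq_mkop => c b; rewrite /pull_bilocal /amp !sum_ord2 !bit_mk //= !addr0.
  by ring.
rewrite (@mulmx_relabel R [:: 2; 3]%N [:: 1; 2; 3]%N 2 3) //.
by apply: eq_mkop => c b; rewrite !bit_mk.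
Qed.

End ClosedForms.

(** * Products of XX and ZZ, and their commutation with Bell-diagonal states *)

Section PauliOperators.
Variable R : realType.
Local Notation C := R[i].
Local Notation basis := Defs.basis.
Implicit Types (s t : register) (q : qubit).

Definition parity_sign (a : 'I_2) : C := (-1) ^+ a.

Lemma parity_signD a b : parity_sign (a + b) = parity_sign a * parity_sign b.
Proof.
by rewrite /parity_sign; elim/ord2_ind: a; elim/ord2_ind: b;
  rewrite ?addr0 ?add0r ?ord2_addbb /=; ring.
Qed.

Lemma ord2_addxx (a : 'I_2) : a + a = 0.
Proof. by elim/ord2_ind: a; apply/val_inj. Qed.

(** The eigenvalue at the basis vector [b] of the product of ZZ over the pairs with [zeta x = 1]. *)
Definition pauli_sign s (zeta : nat -> 'I_2) (b : basis s) : C :=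
  \prod_(x : seq_sub s)
    parity_sign (zeta (val x) * (b (x, alice) + b (x, bob))).

Definition flip s (delta : nat -> 'I_2) (b : basis s) : basis s :=
  mk s (fun q => bit b q + delta q.1).

(* XX on the pairs x with delta x = 1, after ZZ on those with zeta x = 1. *)
Definition pauli s (delta zeta : nat -> 'I_2) : op R s s :=
  mkop (fun c b => pauli_sign zeta b * (c == flip delta b)%:R).

Lemma bit_val s (b : basis s) (x : seq_sub s) h : bit b (val x, h) = b (x, h).
Proof. by rewrite /bit valK. Qed.

Lemma flipE s delta (b : basis s) (x : seq_sub s) h :
  flip delta b (x, h) = b (x, h) + delta (val x).
Proof. by rewrite ffunE bit_val. Qed.

Lemma flip_flip s delta delta' (b : basis s) :
  flip delta (flip delta' b) = flip (fun x => delta x + delta' x) b.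
Proof.
by apply/ffunP => -[x h]; rewrite !flipE -addrA [delta' _ + _]addrC.
Qed.

Lemma flipK s delta : involutive (@flip s delta).
Proof. by move=> b; apply/ffunP => -[x h]; rewrite !flipE -addrA ord2_addxx addr0. Qed.

(** XX flips both bits of a pair and so keeps their parity. Hence XX and ZZ commute, and the [pauli]
    operators multiply without phases. *)
Lemma pauli_sign_flip s delta zeta (b : basis s) :
  pauli_sign zeta (flip delta b) = pauli_sign zeta b.
Proof.
by apply: eq_bigr => x _; rewrite !flipE addrACA ord2_addxx addr0.
Qed.

Lemma eq_flip s delta (b c : basis s) : (c == flip delta b) = (b == flip delta c).
Proof. by rewrite eq_sym (can2_eq (flipK delta) (flipK delta)). Qed.

Lemma mulmx_pauli s u delta zeta (g : basis u -> basis s -> C) :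
  mkop g *m pauli s delta zeta =
  mkop (fun c b => pauli_sign zeta b * g c (flip delta b)).
Proof.
rewrite mulmx_mkop; apply: eq_mkop => c b.
rewrite (bigD1 (flip delta b)) //= eqxx big1 => [|d /negPf ->].
  by rewrite addr0 mulr1 mulrC.
by rewrite !mulr0.
Qed.

Lemma pauli_mulmx s u delta zeta (g : basis s -> basis u -> C) :
  pauli s delta zeta *m mkop g =
  mkop (fun c b => pauli_sign zeta c * g (flip delta c) b).
Proof.
rewrite mulmx_mkop; apply: eq_mkop => c b.
rewrite (bigD1 (flip delta c)) //= flipK eqxx big1 => [|d nd].
  by rewrite addr0 mulr1 pauli_sign_flip.
by rewrite eq_flip (negPf nd) mulr0 mul0r.
Qed.

Lemma pauliM s delta zeta delta' zeta' :
  pauli s delta zeta *m pauli s delta' zeta' =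
  pauli s (fun x => delta x + delta' x) (fun x => zeta x + zeta' x).
Proof.
rewrite {1}/pauli mulmx_pauli; apply: eq_mkop => c b.
rewrite pauli_sign_flip flip_flip mulrA -big_split /=; congr (_ * _).
by apply: eq_bigr => x _; rewrite -parity_signD -mulrDl addrC.
Qed.

Lemma eq_pauli s delta zeta delta' zeta' :
  {in s, delta =1 delta'} -> {in s, zeta =1 zeta'} ->
  pauli s delta zeta = pauli s delta' zeta'.
Proof.
move=> de ze; apply: eq_mkop => c b.
have -> : flip delta b = flip delta' b by apply: eq_mk => q qs; rewrite de.
by congr (_ * _); apply: eq_bigr => x _; rewrite ze //; exact: (valP x).
Qed.

Lemma pauli0 s : pauli s (fun=> 0) (fun=> 0) = 1%:M.
Proof.
rewrite -mkop_id; apply: eq_mkop => c b.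
rewrite /pauli_sign big1 ?mul1r => [|x _]; last by rewrite mul0r.
by have -> : flip (fun=> 0) b = b by apply/ffunP => -[x h]; rewrite flipE addr0.
Qed.

Lemma adj_mkop s t (f : basis t -> basis s -> C) :
  (mkop f)^t* = mkop (fun c b => (f b c)^*).
Proof. by apply/matrixP => i j; rewrite !mxE. Qed.

Lemma adj_pauli s delta zeta : (pauli s delta zeta)^t* = pauli s delta zeta.
Proof.
rewrite adj_mkop; apply: eq_mkop => c b.
rewrite rmorphM rmorph_prod rmorph_nat eq_flip; case: eqP => [->|_]; last by rewrite !mulr0.
rewrite -(pauli_sign_flip delta) !mulr1; apply: eq_bigr => x _.
by rewrite /parity_sign rmorphXn rmorphN rmorph1.
Qed.

(** State and Pauli operators are both products over the pairs, so commutation is a condition on one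
    pair. The hypothesis is the entrywise form of commuting with XX to the power [d] times ZZ to the
    power [z]. *)
Lemma tensor_pauli s (chi : nat -> 'M[C]_(2 * 2)) delta zeta :
  (forall x a b a' b' d z, x \in s ->
    parity_sign (z * (a + b)) *
      chi x (mxtens_index (a + d, b + d)) (mxtens_index (a', b')) =
    parity_sign (z * (a' + b')) *
      chi x (mxtens_index (a, b)) (mxtens_index (a' + d, b' + d))) ->
  pauli s delta zeta *m tensor_state s chi =
  tensor_state s chi *m pauli s delta zeta.
Proof.
move=> chiP; rewrite /tensor_state pauli_mulmx mulmx_pauli.
apply: eq_mkop => c b; rewrite -!big_split /=.
apply: eq_bigr => x _; rewrite !flipE; apply: chiP; exact: (valP x).
Qed.

Lemma ket2E a b i j :
  ket2 R a b (mxtens_index (i, j)) 0 = ((i == a) && (j == b))%:R.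
Proof.
(* The column index 0 has to be written as a pair index before the entry formula for tensor products
   applies. *)
transitivity (ket2 R a b (mxtens_index (i, j)) (mxtens_index (0 : 'I_1, 0 : 'I_1))).
  by congr (ket2 _ _ _ _ _); apply/val_inj.
etransitivity.
  exact: (tensmxE (delta_mx a 0 : 'cV[C]_2) (delta_mx b 0 : 'cV[C]_2) i j 0 0).
by rewrite !mxE !andbT -natrM mulnb.
Qed.

(** [even e] and [odd e] give the coordinates of the unnormalized vectors |00> + e|11> and |01> +
    e|10>. *)
Lemma bell_diagonalE (p0 p1 p2 p3 : R) k l i j :
  let even e (m n : 'I_2) : C := ((m == 0) && (n == 0))%:R + e * ((m == 1) && (n == 1))%:R in
  let odd e (m n : 'I_2) : C := ((m == 0) && (n == 1))%:R + e * ((m == 1) && (n == 0))%:R in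
  bell_diagonal p0 p1 p2 p3 (mxtens_index (k, l)) (mxtens_index (i, j)) =
  (sqrtC 2)^-1 * ((sqrtC 2)^-1)^* *
    (p0%:C * (even 1 k l * even 1 i j) + p1%:C * (odd (-1) k l * odd (-1) i j) +
     p2%:C * (odd 1 k l * odd 1 i j) + p3%:C * (even (-1) k l * even (-1) i j)).
Proof.
move=> even odd.
have sumE (u0 u1 u2 u3 : 'cV[C]_(2 * 2)) m n :
    (p0%:C *: (u0 *m u0^t*) + p1%:C *: (u1 *m u1^t*) + p2%:C *: (u2 *m u2^t*)
      + p3%:C *: (u3 *m u3^t*)) m n =
    p0%:C * (u0 m 0 * (u0 n 0)^*) + p1%:C * (u1 m 0 * (u1 n 0)^*)
      + p2%:C * (u2 m 0 * (u2 n 0)^*) + p3%:C * (u3 m 0 * (u3 n 0)^*).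
  by rewrite !mxE !big_ord1 !mxE.
have addE h (u v : 'cV[C]_(2 * 2)) m : (h *: (u + v)) m 0 = h * (u m 0 + v m 0).
  by rewrite !mxE.
have subE h (u v : 'cV[C]_(2 * 2)) m : (h *: (u - v)) m 0 = h * (u m 0 - v m 0).
  by rewrite !mxE.
have PhiPE m : PhiP R m 0 = _ := addE _ _ _ m.
have PsiPE m : PsiP R m 0 = _ := addE _ _ _ m.
have PhiME m : PhiM R m 0 = _ := subE _ _ _ m.
have PsiME m : PsiM R m 0 = _ := subE _ _ _ m.
rewrite /bell_diagonal.
(* The Bell vectors become variables known only through their coordinates, which keeps the tensor
   products folded. *)
move: (PhiP R) PhiPE (PsiP R) PsiPE (PhiM R) PhiME (PsiM R) PsiME.
move=> u0 u0E u2 u2E u3 u3E u1 u1E.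
rewrite sumE !(u0E, u1E, u2E, u3E).
move: (ket2 R) (@ket2E) => ket ketE; rewrite !ketE.
rewrite !(rmorphM, rmorphB, rmorphD, rmorph_nat) /=.
by rewrite /even /odd; ring.
Qed.

(** Bell states are joint eigenvectors of XX and ZZ, so any combination of their projectors commutes
    with both. The proof checks all values of the six bits. *)
Lemma bell_diagonal_pauli (p0 p1 p2 p3 : R) a b a' b' d z :
  parity_sign (z * (a + b)) *
    bell_diagonal p0 p1 p2 p3 (mxtens_index (a + d, b + d)) (mxtens_index (a', b')) =
  parity_sign (z * (a' + b')) *
    bell_diagonal p0 p1 p2 p3 (mxtens_index (a, b)) (mxtens_index (a' + d, b' + d)).
Proof.
rewrite !bell_diagonalE /= /parity_sign.
elim/ord2_ind: z; elim/ord2_ind: d; elim/ord2_ind: a; elim/ord2_ind: b;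
  elim/ord2_ind: a'; elim/ord2_ind: b';
  by rewrite ?addr0 ?add0r ?ord2_addxx ?mulr0 ?mul0r ?mulr1 /=; ring.
Qed.

End PauliOperators.

(** * Outcome shifts and stabilizers of the two-step operators *)

Section PauliSymmetry.
Variable R : realType.
Local Notation C := R[i].
Local Notation basis := Defs.basis.
Implicit Types (s t : register) (q : qubit).

Lemma bit_flip s delta (b : basis s) q :
  q.1 \in s -> bit (flip delta b) q = bit b q + delta q.1.
Proof. exact: bit_mk. Qed.

Lemma prod_seq_sub s (F : nat -> C) : uniq s ->
  \prod_(x : seq_sub s) F (val x) = \prod_(x <- s) F x.
Proof.
move=> us; rewrite -(big_map val xpredT F); apply: perm_big.
apply: uniq_perm => //; first by rewrite (map_inj_uniq val_inj) index_enum_uniq.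
move=> x; apply/mapP/idP => [[y _ ->]|xs]; first exact: (valP y).
by exists (SeqSub xs); rewrite ?mem_index_enum.
Qed.

Lemma pauli_signE s zeta (b : basis s) : uniq s ->
  pauli_sign R zeta b = \prod_(x <- s)
    parity_sign R (zeta x * (bit b (x, alice) + bit b (x, bob))).
Proof.
move=> us; rewrite -(prod_seq_sub (fun x =>
  parity_sign R (zeta x * (bit b (x, alice) + bit b (x, bob)))) us).
by apply: eq_bigr => x _; rewrite !bit_val.
Qed.

(** [U a b] depends only on [a + b], so [i] moves onto [b3]. Shifting the summation bit of [amp] by
    [j] then moves [j] from the outcome onto [b2] and [b3]. *)
Lemma amp_shift (U : 'M[C]_2) p v j i c b1 b2 b3 :
  (forall a b, U a b = p * (if a == b then 1 else v)) ->
  amp U j i c b1 b2 b3 = amp U 0 0 c b1 (b2 + j) (b3 + (i + j)).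
Proof.
move=> UE; rewrite /amp !sum_ord2 !UE.
elim/ord2_ind: i; elim/ord2_ind: j; elim/ord2_ind: b2; elim/ord2_ind: b3;
  by elim/ord2_ind: c; rewrite ?addr0 ?add0r ?ord2_addxx ?addr0 ?add0r ?ord2_addxx /=; ring.
Qed.

(** One party's half of the stabilizer: Z on the qubit measured second pulls back, up to sign, to Y
    on qubit 1, Z on qubit 2 and X on qubit 3. Writing Y as a multiple of XZ leaves the scalar
    [- v]. *)
Lemma amp_stab (U : 'M[C]_2) p v c b1 b2 b3 :
  v * v = -1 -> (forall a b, U a b = p * (if a == b then 1 else v)) ->
  parity_sign R (b1 + b2) * amp U 0 0 c (b1 + 1) b2 (b3 + 1) =
  - v * amp U 0 0 c b1 b2 b3.
Proof.
move=> v2 UE; rewrite /amp !sum_ord2 !UE /parity_sign.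
elim/ord2_ind: b1; elim/ord2_ind: b2; elim/ord2_ind: b3; elim/ord2_ind: c;
  by rewrite ?addr0 ?add0r ?ord2_addxx ?addr0 ?add0r ?ord2_addxx /=; ring: v2.
Qed.

(** The leading 0 puts the value for pair [x] at position [x], as pairs are numbered from 1. *)
Definition on3 (a1 a2 a3 : 'I_2) (x : nat) : 'I_2 := [:: 0; a1; a2; a3]`_x.

Local Notation full := [:: 1; 2; 3]%N.
Local Notation FO j i := (opF R j *m opO R i).
Local Notation FP j i := (opF R j *m opP R i).

Lemma pauli_sign_on3 a1 a2 a3 (b : basis full) :
  pauli_sign R (on3 a1 a2 a3) b =
  parity_sign R (a1 * (bit b (1%N, alice) + bit b (1%N, bob))) *
  parity_sign R (a2 * (bit b (2%N, alice) + bit b (2%N, bob))) *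
  parity_sign R (a3 * (bit b (3%N, alice) + bit b (3%N, bob))).
Proof. by rewrite pauli_signE // !big_cons big_nil mulr1 mulrA. Qed.

(** Both parties obtain the same bits, so the shifts given by [amp_shift] flip both qubits of a pair
    and combine to XX. *)
Lemma opFO_shift j i :
  FO (j, j) (i, i) = FO (0, 0) (0, 0) *m pauli R full (on3 0 j (i + j)) (on3 0 0 0).
Proof.
rewrite !opFOE mulmx_pauli; apply: eq_mkop => c b.
rewrite pauli_sign_on3 !mul0r !mul1r !bit_flip //= /on3 /= !addr0.
rewrite (amp_shift _ _ _ _ _ _ (@RgateE R)).
by rewrite [X in _ * X](amp_shift _ _ _ _ _ _ (@RgatedagE R)).
Qed.

Lemma imaginary_sqr : ('i : C) * 'i = -1.
Proof. by rewrite -expr2 sqrCi. Qed.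

Lemma stab_reorder (a a' b b' x y : C) :
  a * a' * (b * b') * parity_sign R 0 * (x * y) = a * b * x * (a' * b' * y).
Proof. by rewrite /parity_sign /=; ring. Qed.

Lemma opp_imaginary_sqr : (- 'i : C) * - 'i = -1.
Proof. by rewrite mulrNN imaginary_sqr. Qed.

Lemma opFO_stab :
  FO (0, 0) (0, 0) *m pauli R full (on3 1 0 1) (on3 1 1 0) = FO (0, 0) (0, 0).
Proof.
rewrite !opFOE mulmx_pauli; apply: eq_mkop => c b.
rewrite pauli_sign_on3 mul0r !mul1r !bit_flip //= /on3 /= !addr0.
have amp_stab_alice := amp_stab (bit c (1%N, alice)) (bit b (1%N, alice))
  (bit b (2%N, alice)) (bit b (3%N, alice)) opp_imaginary_sqr (@RgateE R).
have amp_stab_bob := amp_stab (bit c (1%N, bob)) (bit b (1%N, bob))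
  (bit b (2%N, bob)) (bit b (3%N, bob)) imaginary_sqr (@RgatedagE R).
(* Alice's eigenvalue is ['i] and Bob's is [- 'i]; their product is 1, so the two-party operator is
   fixed exactly. *)
have ii : - - 'i * - 'i = 1 :> C by rewrite opprK mulrN imaginary_sqr opprK.
rewrite -[RHS]mul1r -ii [RHS]mulrACA -amp_stab_alice -amp_stab_bob.
by rewrite !parity_signD stab_reorder.
Qed.

Lemma opFP_shift j i :
  FP (j, j) (i, i) = FP (0, 0) (0, 0) *m pauli R full (on3 j 0 (i + j)) (on3 0 0 0).
Proof.
rewrite !opFPE mulmx_pauli; apply: eq_mkop => c b.
rewrite pauli_sign_on3 !mul0r !mul1r !bit_flip //= /on3 /= !addr0.
rewrite (amp_shift _ _ _ _ _ _ (@RgateE R)).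
by rewrite [X in _ * X](amp_shift _ _ _ _ _ _ (@RgatedagE R)).
Qed.

Lemma opFP_stab :
  FP (0, 0) (0, 0) *m pauli R full (on3 0 1 1) (on3 1 1 0) = FP (0, 0) (0, 0).
Proof.
rewrite !opFPE mulmx_pauli; apply: eq_mkop => c b.
rewrite pauli_sign_on3 mul0r !mul1r !bit_flip //= /on3 /= !addr0.
have amp_stab_alice := amp_stab (bit c (1%N, alice)) (bit b (2%N, alice))
  (bit b (1%N, alice)) (bit b (3%N, alice)) opp_imaginary_sqr (@RgateE R).
have amp_stab_bob := amp_stab (bit c (1%N, bob)) (bit b (2%N, bob))
  (bit b (1%N, bob)) (bit b (3%N, bob)) imaginary_sqr (@RgatedagE R).
have ii : - - 'i * - 'i = 1 :> C by rewrite opprK mulrN imaginary_sqr opprK.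
rewrite -[RHS]mul1r -ii [RHS]mulrACA -amp_stab_alice -amp_stab_bob.
by rewrite [parity_sign R _ * parity_sign R _]mulrC !parity_signD stab_reorder.
Qed.

Lemma adj_mulmx m n p (M : 'M[C]_(m, n)) (N : 'M[C]_(n, p)) :
  (M *m N)^t* = N^t* *m M^t*.
Proof. by rewrite trmx_mul map_mxM. Qed.

Lemma sum_outcomes_const (V : lmodType C) (f : 'I_2 * 'I_2 -> 'I_2 * 'I_2 -> V) v :
  (forall i j, f (i, i) (j, j) = v) ->
  \sum_(i <- outcomes) \sum_(j <- outcomes) f i j = 4 *: v.
Proof.
by move=> fE; rewrite !big_cons !big_nil !addr0 !fE scaler_nat !mulrS mulr0n addr0 !addrA.
Qed.

(** * Equality of the outcome terms, and their sum *)

Section Sandwich.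
Variable rho : op R full full.
Hypothesis rhoC : forall delta zeta,
  pauli R full delta zeta *m rho = rho *m pauli R full delta zeta.

(** The Pauli operator on the right is self-adjoint, and the left one moves through [rho] to meet
    it. *)
Lemma pauli_sandwich m n (G : 'M[C]_(m, _)) (H : 'M[C]_(n, _)) delta zeta delta' zeta' :
  (G *m pauli R full delta zeta) *m rho *m (H *m pauli R full delta' zeta')^t* =
  G *m rho *m pauli R full (fun x => delta x + delta' x) (fun x => zeta x + zeta' x)
    *m H^t*.
Proof.
by rewrite adj_mulmx adj_pauli -pauliM -(mulmxA G) rhoC !mulmxA.
Qed.

Lemma pauli_sandwich1 m n (G : 'M[C]_(m, _)) (H : 'M[C]_(n, _)) delta zeta delta' zeta' :
  {in full, forall x, delta x = delta' x} -> {in full, forall x, zeta x = zeta' x} ->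
  (G *m pauli R full delta zeta) *m rho *m (H *m pauli R full delta' zeta')^t* =
  G *m rho *m H^t*.
Proof.
move=> de ze; rewrite pauli_sandwich.
rewrite (@eq_pauli _ full _ _ (fun=> 0) (fun=> 0)) ?pauli0 ?mulmx1 // => x xs.
  by rewrite de // ord2_addxx.
by rewrite ze // ord2_addxx.
Qed.

Lemma opFO_opFO j i :
  FO (j, j) (i, i) *m rho *m (FO (j, j) (i, i))^t* =
  FO (0, 0) (0, 0) *m rho *m (FO (0, 0) (0, 0))^t*.
Proof. by rewrite opFO_shift pauli_sandwich1. Qed.

Lemma opFP_opFP j i :
  FP (j, j) (i, i) *m rho *m (FP (j, j) (i, i))^t* =
  FP (0, 0) (0, 0) *m rho *m (FP (0, 0) (0, 0))^t*.
Proof. by rewrite opFP_shift pauli_sandwich1. Qed.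

(** [sG] and [sH] are the XX parts of stabilizers of [G] and [H] that share the sign part ZZ1 ZZ2;
    [dG] and [dH] are the outcome shifts. *)
Lemma mixed_sandwich m n (G : 'M[C]_(m, _)) (H : 'M[C]_(n, _)) sG sH dG dH j :
  G *m pauli R full sG (on3 1 1 0) = G -> H *m pauli R full sH (on3 1 1 0) = H ->
  {in full, forall x, sG x + sH x = on3 1 1 0 x} ->
  {in full, forall x, dG x + dH x = on3 j j 0 x} ->
  (G *m pauli R full dG (on3 0 0 0)) *m rho *m
    (H *m pauli R full dH (on3 0 0 0))^t* = G *m rho *m H^t*.
Proof.
move=> GS HS sE dE; rewrite pauli_sandwich; elim/ord2_ind: j dE => dE.
  rewrite (@eq_pauli _ full _ _ (fun=> 0) (fun=> 0)) ?pauli0 ?mulmx1 // => x xs.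
    by rewrite dE //; move: xs; rewrite !inE => /or3P[] /eqP ->.
  by rewrite ord2_addxx.
(* Inserting both stabilizers on the right cancels their ZZ parts and produces XX on pairs 1 and 2,
   which is what the outcome shifts leave on the left. *)
rewrite -[in RHS]GS -[in RHS]HS pauli_sandwich.
congr (_ *m _ *m _); apply: eq_pauli => x xs; first by rewrite dE ?sE.
by rewrite !ord2_addxx.
Qed.

Lemma on3D a1 a2 a3 b1 b2 b3 x :
  on3 a1 a2 a3 x + on3 b1 b2 b3 x = on3 (a1 + b1) (a2 + b2) (a3 + b3) x.
Proof. by move: x => [|[|[|[|x]]]]; rewrite /on3 /= ?nth_nil ?addr0. Qed.

Lemma opFP_opFO j i :
  FP (j, j) (i, i) *m rho *m (FO (j, j) (i, i))^t* =
  FP (0, 0) (0, 0) *m rho *m (FO (0, 0) (0, 0))^t*.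
Proof.
rewrite opFP_shift opFO_shift; apply: (mixed_sandwich (j := j) opFP_stab opFO_stab) => x _;
  by rewrite on3D ?ord2_addxx ?addr0 ?add0r.
Qed.

Lemma opFO_opFP j i :
  FO (j, j) (i, i) *m rho *m (FP (j, j) (i, i))^t* =
  FO (0, 0) (0, 0) *m rho *m (FP (0, 0) (0, 0))^t*.
Proof.
rewrite opFP_shift opFO_shift; apply: (mixed_sandwich (j := j) opFO_stab opFP_stab) => x _;
  by rewrite on3D ?ord2_addxx ?addr0 ?add0r.
Qed.

(** Common form of the four identities: [K] and [L] stand for [opO] or [opP] on the two sides of
    [rho], and [A *m B], [A' *m B'] for the matching products of [opQ1] and [opQ2]. Four equal terms
    on the left meet a factor 2 from each side on the right. *)
Lemma sum_outcomes s s' t (K L : 'I_2 * 'I_2 -> op R full [:: 1; 2]%N)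
    (J : op R [:: 1%N] t) (A : op R s t) (B : op R full s)
    (A' : op R s' t) (B' : op R full s') :
  (forall j i,
    (opF R (j, j) *m K (i, i)) *m rho *m (opF R (j, j) *m L (i, i))^t* =
    (opF R (0, 0) *m K (0, 0)) *m rho *m (opF R (0, 0) *m L (0, 0))^t*) ->
  A *m B = 2 *: (J *m (opF R (0, 0) *m K (0, 0))) ->
  A' *m B' = 2 *: (J *m (opF R (0, 0) *m L (0, 0))) ->
  J *m (\sum_(i <- outcomes) \sum_(j <- outcomes)
    opF R j *m K i *m rho *m (L i)^t* *m (opF R j)^t*) *m J^t* =
  A *m B *m rho *m B'^t* *m A'^t*.
Proof.
move=> KL AB AB'.
have KL' j i : opF R (j, j) *m K (i, i) *m rho *m (L (i, i))^t* *m (opF R (j, j))^t* =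
    (opF R (0, 0) *m K (0, 0)) *m rho *m (opF R (0, 0) *m L (0, 0))^t*.
  by rewrite -(KL j i) adj_mulmx (mulmxA _ ((L (i, i))^t*)).
rewrite -(mulmxA _ (B'^t*)) -adj_mulmx AB AB'.
set S := \sum_(_ <- _) _; have -> := sum_outcomes_const (fun i j => KL' j i) : S = _.
move: (opF R _ *m K _) (opF R _ *m L _) => G H.
rewrite [(2 *: _)^t*](_ : _ = 2 *: (H^t* *m J^t*)); last first.
  by rewrite -adj_mulmx; apply/matrixP => k l; rewrite !mxE rmorphM rmorph_nat.
rewrite -!scalemxAr -!scalemxAl scalerA -natrM.
by rewrite !mulmxA.
Qed.
End Sandwich.

Lemma tensor_bell_pauli (A B D E : nat -> R) delta zeta :
  let rho := tensor_state full (fun i => bell_diagonal (A i) (B i) (D i) (E i)) in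
  pauli R full delta zeta *m rho = rho *m pauli R full delta zeta.
Proof. by apply: tensor_pauli => *; apply: bell_diagonal_pauli. Qed.

End PauliSymmetry.

Unset Implicit Arguments.
Set Strict Implicit.
Set Printing Implicit Defensive.

Theorem theorem1 (R : realType) (A B C D : nat -> R)
  (ABCD_ge0 : forall i : nat, i \in [:: 1; 2; 3]%N ->
     [/\ 0 <= A i, 0 <= B i, 0 <= C i & 0 <= D i])
  (ABCD_sum1 : forall i : nat, i \in [:: 1; 2; 3]%N ->
     A i + B i + C i + D i = 1) :
  let full : register := [:: 1; 2; 3]%N in
  let chi (i : nat) := bell_diagonal (A i) (B i) (C i) (D i) in
  let rho : op R full full := tensor_state full chi in
  let N1 : op R [:: 1]%N [:: 1]%N := \sum_(i <- outcomes) \sum_(j <- outcomes)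
    opF R j *m opO R i *m rho *m (opO R i) ^t* *m (opF R j) ^t* in
  let N2 : op R [:: 1]%N [:: 1]%N := \sum_(i <- outcomes) \sum_(j <- outcomes)
    opF R j *m opP R i *m rho *m (opP R i) ^t* *m (opF R j) ^t* in
  let M1 : op R [:: 1]%N [:: 1]%N := \sum_(i <- outcomes) \sum_(j <- outcomes)
    opF R j *m opP R i *m rho *m (opO R i) ^t* *m (opF R j) ^t* in
  let M2 : op R [:: 1]%N [:: 1]%N := \sum_(i <- outcomes) \sum_(j <- outcomes)
    opF R j *m opO R i *m rho *m (opP R i) ^t* *m (opF R j) ^t* in
  let J : op R [:: 1]%N [:: 3]%N := relabel R 1 3 [:: 1; 3]%N in
  let Q1 : op R full [:: 1; 3]%N := opQ1 R full in
  let Q2 : op R full [:: 2; 3]%N := opQ2 R full in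
  let Q1' : op R [:: 2; 3]%N [:: 3]%N := opQ1 R [:: 2; 3]%N in
  let Q2' : op R [:: 1; 3]%N [:: 3]%N := opQ2 R [:: 1; 3]%N in
  [/\ J *m N1 *m J ^t* = Q2' *m Q1 *m rho *m Q1 ^t* *m Q2' ^t*,
      J *m N2 *m J ^t* = Q1' *m Q2 *m rho *m Q2 ^t* *m Q1' ^t*,
      J *m M1 *m J ^t* = Q1' *m Q2 *m rho *m Q1 ^t* *m Q2' ^t* &
      J *m M2 *m J ^t* = Q2' *m Q1 *m rho *m Q2 ^t* *m Q1' ^t*] /\
  (forall s : register, s \in [:: full; [:: 2; 3]%N] ->
     bra R 2 (0, 0) s *m swap_pairs R 2 3 s
       = relabel R 2 3 s *m bra R 3 (0, 0) s /\
     opQ1 R s = relabel R 2 3 s *m dejmps00 R 2 3 s) /\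
  (forall s : register, s \in [:: full; [:: 1; 3]%N] ->
     bra R 1 (0, 0) s *m swap_pairs R 1 3 s
       = relabel R 1 3 s *m bra R 3 (0, 0) s /\
     opQ2 R s = relabel R 1 3 s *m dejmps00 R 1 3 s).

Proof.
move=> full chi rho N1 N2 M1 M2 J Q1 Q2 Q1' Q2'.
have rhoC := @tensor_bell_pauli R A B C D.
split; last first.
  by split=> s; rewrite !inE => /orP[] /eqP ->; split;
    by [rewrite bra_swap_pairs | rewrite opQ1E | rewrite opQ2E].
split.
- exact: (sum_outcomes (opFO_opFO rhoC) (@opQ21E R) (@opQ21E R)).
- exact: (sum_outcomes (opFP_opFP rhoC) (@opQ12E R) (@opQ12E R)).
- exact: (sum_outcomes (opFP_opFO rhoC) (@opQ12E R) (@opQ21E R)).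
- exact: (sum_outcomes (opFO_opFP rhoC) (@opQ21E R) (@opQ12E R)).
Qed.
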